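(* Let $\mathcal{G} = (V,d,\alpha,p)$ be a game structure (with $V$ nonempty), let $\alpha_{\max} = \max_{v\in V}\alpha(v)$, and let $\mathcal{L}_{\mathcal{G}}$ be the following system of $|V|$ equations in the $|V|+1$ real unknowns $\varrho$ and $Q_v$ ($v \in V$): for every $v \in V$, $$\varrho = \alpha_{\max} - \alpha(v)\cdot (1-p)^{\lfloor Q_v\rfloor}\cdot\bigl(1-p\cdot(Q_v-\lfloor Q_v\rfloor)\bigr) \quad\text{if } p<1,$$ $$\varrho = \alpha_{\max} - \alpha(v)\cdot(1-Q_v)\quad\text{if } p=1.$$ (a) Let $k\in\mathbb{N}$ with $1 \le k \leq |V|$ be a number of patrollers. If $\varrho$, $(Q_v)_{v\in V}$ is a solution of the system $\mathcal{L}_{\mathcal{G}}$ extended with the equation $k = \sum_{v\in V,\, Q_v>0} Q_v/d(v)$, then the level of protection achievable with $k$ patrollers is bounded from above by $\varrho$, i.e., $\mathit{Lev}_k \leq \varrho$. (b) Let $\tau \geq 0$ be a real number (a desired level of protection), and consider the system obtained by extending $\mathcal{L}_{\mathcal{G}}$ with the equation $\tau = \varrho$. - If this system has no solution such that $Q_v \leq d(v)$ for all $v\in V$ (in the case $p=1$: no solution such that $Q_v \leq 1$ for all $v \in V$), then the level of protection $\tau$ is not achievable with any number of patrollers. - Otherwise, every number $k$ of patrollers with which the level of protection $\tau$ is achievable satisfies $k \geq \left\lceil \sum_{v\in V,\,Q_v>0} Q_v/d(v)\right\rceil$, where the values $Q_v$ are those of the solution of the system.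
   Context: $\mathbb{N}_0$ and $\mathbb{N}$ denote the non-negative and the positive integers. For a set $A$, $A^{\langle k\rangle}$ denotes the set of all subsets of $A$ with exactly $k$ elements. **Game structure.** A game structure is a tuple $\mathcal{G}=(V,d,\alpha,p)$, where $V$ is a finite set of vertices, $d:V\to\mathbb{N}$ (attack length: number of time units needed to complete an intrusion at a vertex), $\alpha:V\to\mathbb{N}$ (cost/importance of a vertex), and $p\in(0,1]$ (probability that a patroller visiting a vertex under attack discovers the attack). $\alpha_{\max}$ is the maximal value of $\alpha$ on $V$. **Defender's strategy.** Let $k\in\mathbb{N}$, $k\le|V|$, be the number of patrollers. A history is a finite sequence $U_1,\dots,U_\ell$ ($\ell\ge 0$, with the empty history for $\ell=0$) of elements of $V^{\langle k\rangle}$; $U_i$ is the set of vertices visited in round $i$. A Defender's strategy $\eta$ (for $k$ patrollers) is a function assigning to every history a probability distribution over $V^{\langle k\rangle}$ (the distribution of the set visited in the next round). It determines, in the standard way, a unique probability space over all walks, i.e., infinite sequences $U_1,U_2,\dots$ of elements of $V^{\langle k\rangle}$. **Attacker's strategy.** An Attacker's strategy is a function $\pi$ assigning to every history an element of $V\cup\{\bot\}$ such that whenever $\pi(U_1,\dots,U_\ell)\ne\bot$, then $\pi(U_1,\dots,U_j)=\bot$ for all $0 \le j<\ell$ (the Attacker attacks at most once along a walk). **Damage.** For a walk $w=U_1,U_2,\dots$, the damage $\mathit{Damage}^\pi(w)$ is $0$ if $\pi(U_1,\dots,U_\ell)=\bot$ for all $\ell\in\mathbb{N}_0$. Otherwise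 there is a (unique) $\ell\in\mathbb{N}_0$ with $\pi(U_1,\dots,U_\ell)=v\in V$, and $\mathit{Damage}^\pi(w)=(1-p)^c\cdot\alpha(v)$, where $c$ is the number of all $i\in\{1,\dots,d(v)\}$ such that $v\in U_{\ell+i}$ (with the convention $0^0=1$, i.e., the damage is $\alpha(v)$ if $p=1$ and $c=0$). **Level of protection.** $\mathit{Lev}(\eta,\pi)=\alpha_{\max}-\mathbb{E}^\eta[\mathit{Damage}^\pi]$, where $\mathbb{E}^\eta$ is the expectation in the probability space over walks determined by $\eta$; $\mathit{Lev}(\eta)=\inf_\pi \mathit{Lev}(\eta,\pi)$, where $\pi$ ranges over all Attacker's strategies; and $\mathit{Lev}_k=\sup_\eta \mathit{Lev}(\eta)$, where $\eta$ ranges over all Defender's strategies for $k$ patrollers. $\mathit{Lev}_k$ is the maximal level of protection achievable with $k$ patrollers, and a level of protection $\tau$ is achievable with $k$ patrollers if $\mathit{Lev}_k\ge\tau$ (where $1\le k\le|V|$). *)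

(* Defs.v *)
From HB Require Import structures.
From mathcomp Require Import all_boot all_order all_algebra.
From mathcomp Require Import all_classical all_reals all_analysis.

Set Implicit Arguments.
Unset Strict Implicit.
Unset Printing Implicit Defensive.

Import Order.TTheory GRing.Theory Num.Theory.

Local Open Scope classical_set_scope.
Local Open Scope ring_scope.

Record game (R : realType) := Game {
  vertex :> finType;
  attack_len : vertex -> nat;
  cost : vertex -> nat;
  detect : R;
  attack_len_gt0 : forall v, (0 < attack_len v)%N;
  cost_gt0 : forall v, (0 < cost v)%N;
  detect_gt0 : 0 < detect;
  detect_le1 : detect <= 1
}.

Definition max_cost (R : realType) (G : game R) : nat := \max_(v : G) cost v.

Definition patrol (V : finType) (k : nat) : finType := {U : {set V} | #|U| == k}.

(* Rounds are numbered from 0: the set visited in round i of the usual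
   numbering from 1 is [w i.-1], and [hist w n] lists the first n visited
   sets. *)
Definition walk (V : finType) (k : nat) := nat -> patrol V k.

Definition hist (V : finType) (k n : nat) (w : walk V k) : seq (patrol V k) :=
  mkseq w n.

Record defender (R : realType) (V : finType) (k : nat) := Defender {
  next :> seq (patrol V k) -> patrol V k -> R;
  next_ge0 : forall h U, 0 <= next h U;
  next_sum1 : forall h, \sum_U next h U = 1
}.

(* [None] stands for bottom (no attack). *)
Record attacker (V : finType) (k : nat) := Attacker {
  attack :> seq (patrol V k) -> option V;
  attack_once : forall h, attack h != None ->
    forall j, (j < size h)%N -> attack (take j h) = None
}.

Lemma defender_inhabited (R : realType) (V : finType) (k : nat)
  (eta : defender R V k) : exists U : patrol V k, U \in patrol V k.
Proof.
have [U _|K0] := pickP (patrol V k); first by exists U.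
have := next_sum1 eta [::]; rewrite big_pred0; last exact: K0.
by move/eqP; rewrite eq_sym oner_eq0.
Qed.

(* The walks, as the carrier of the probability space determined by [eta].
   The carrier of a measurable space has to be pointed; the phantom argument
   [eta] serves only to witness that there is a set of k vertices. *)
Definition walks_of (R : realType) (V : finType) (k : nat)
  (eta : defender R V k) := walk V k.

HB.instance Definition _ (R : realType) (V : finType) (k : nat)
    (eta : defender R V k) := Choice.on (walks_of eta).
HB.instance Definition _ (R : realType) (V : finType) (k : nat)
    (eta : defender R V k) := isPointed.Build (walks_of eta)
  (fun=> xchoose (defender_inhabited eta)).

Definition cylinder (V : finType) (k n : nat) (w : walk V k) :
  set (walk V k) := [set w' | hist n w' = hist n w].

Definition cylinders (R : realType) (V : finType) (k : nat)
  (eta : defender R V k) : set (set (walks_of eta)) :=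
  [set C | exists n w, C = cylinder n w].

Arguments cylinders {R V k} eta _.

Definition sample_space (R : realType) (V : finType) (k : nat)
  (eta : defender R V k) := g_sigma_algebraType (cylinders eta).

Definition is_walk_law (R : realType) (V : finType) (k : nat)
  (eta : defender R V k) (P : probability (sample_space eta) R) : Prop :=
  forall n (w : walk V k),
    P (cylinder n w) = (\prod_(i < n) eta (hist i w) (w i))%:E.

Section walk_law.
Variables (R : realType) (V : finType) (k : nat) (eta : defender R V k).
Local Notation K := (patrol V k).
Local Notation walk := (walk V k).

Let c (h : seq K) (U : K) : R :=
  \sum_(U' | (enum_rank U' < enum_rank U)%N) eta h U'.

Let S (h : seq K) (j : nat) : R := \sum_(U' | (enum_rank U' < j)%N) eta h U'.

Let Sle h i j : (i <= j)%N -> S h i <= S h j.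
Proof.
move=> ij; rewrite /S [leRHS]big_mkcond [leLHS]big_mkcond; apply: ler_sum => U _.
case: ifPn => [lt|_]; first by rewrite (leq_trans lt ij).
by case: ifP => // _; apply: next_ge0.
Qed.

Let SS h U : S h (enum_rank U).+1 = c h U + eta h U.
Proof.
rewrite /S (bigD1 U) //= addrC; congr (_ + _); apply: eq_bigl => U'.
rewrite ltnS leq_eqVlt; case: (eqVneq U' U) => [->|ne] /=.
  by rewrite andbF ltnn.
rewrite andbT; case: eqP => // e.
by move: ne; rewrite (enum_rank_inj (val_inj e)) eqxx.
Qed.

Let S0 h : S h 0 = 0. Proof. by rewrite /S big_pred0. Qed.

Let S1 h : S h #|{: K}| = 1.
Proof.
by rewrite -(next_sum1 eta h); apply: eq_bigl => U; apply: ltn_ord.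
Qed.

Let c_ge0 h U : 0 <= c h U.
Proof. by apply: sumr_ge0 => *; apply: next_ge0. Qed.

Let cD_le1 h U : c h U + eta h U <= 1.
Proof. by rewrite -SS -(S1 h); apply: Sle. Qed.

Let c_ex h y : 0 <= y < 1 -> exists U, c h U <= y < c h U + eta h U.
Proof.
move=> /andP[y0 y1].
have exj : exists j, y < S h j by exists #|{: K}|; rewrite S1.
case: (ex_minnP exj) => -[|j] yj minj; first by rewrite S0 ltNge y0 in yj.
have jK : (j < #|{: K}|)%N by apply: minj; rewrite S1.
exists (enum_val (Ordinal jK)).
rewrite -SS /c -/(S h _) enum_valK /= yj andbT leNgt.
by apply/negP => /minj; rewrite ltnn.
Qed.

Let c_disj h U U' : (enum_rank U < enum_rank U')%N ->
  c h U + eta h U <= c h U'.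
Proof. by move=> lt; rewrite -SS; apply: Sle. Qed.

(* The law of the walk is the image of the uniform law on [0, 1[ under the
   map sending x to the walk all of whose cylinders have an interval
   containing x, where the interval of the cylinder of h is split among the
   one-step extensions of h proportionally to [eta h]. *)
Let PR n (w : walk) : R := \prod_(i < n) eta (hist i w) (w i).
Let LO n (w : walk) : R := \sum_(i < n) PR i w * c (hist i w) (w i).
Let inI n (w : walk) (x : R) := LO n w <= x < LO n w + PR n w.

Let U0 : K := xchoose (defender_inhabited eta).
Let sel (x : R) (s : seq K * (R * R)) : K :=
  odflt U0 [pick U | s.2.1 + s.2.2 * c s.1 U <= x
                     < s.2.1 + s.2.2 * (c s.1 U + eta s.1 U)].
Let st (x : R) := fix st (n : nat) : seq K * (R * R) :=
  if n is m.+1 then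
    let s := st m in let U := sel x s in
    (rcons s.1 U, (s.2.1 + s.2.2 * c s.1 U, s.2.2 * eta s.1 U))
  else ([::], (0, 1)).
Let dec (x : R) : walk := fun n => sel x (st x n).

Let PR_ge0 n w : 0 <= PR n w.
Proof. by apply: prodr_ge0 => *; apply: next_ge0. Qed.

Let PRS n w : PR n.+1 w = PR n w * eta (hist n w) (w n).
Proof. by rewrite /PR big_ord_recr. Qed.

Let LOS n w : LO n.+1 w = LO n w + PR n w * c (hist n w) (w n).
Proof. by rewrite /LO big_ord_recr. Qed.

Let stE x n : st x n = (hist n (dec x), (LO n (dec x), PR n (dec x))).
Proof.
elim: n => [|n IH]; first by rewrite /hist /LO /PR !big_ord0.
rewrite LOS PRS /hist mkseqS -/(hist n (dec x)) /=.
by rewrite /dec -/(dec x) IH.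
Qed.

Let inI_dec x n : 0 <= x < 1 -> inI n (dec x) x.
Proof.
move=> x01; elim: n => [|n IH].
  by rewrite /inI /LO /PR !big_ord0 add0r.
have PR0 : 0 < PR n (dec x).
  by move: IH => /andP[/le_lt_trans h /h]; rewrite ltrDl.
rewrite /inI LOS PRS -addrA -mulrDr.
have [U HU] : exists U, LO n (dec x) + PR n (dec x) * c (hist n (dec x)) U <= x
     < LO n (dec x) + PR n (dec x) *
        (c (hist n (dec x)) U + eta (hist n (dec x)) U).
  have [|U] := @c_ex (hist n (dec x)) ((x - LO n (dec x)) / PR n (dec x)).
    by rewrite divr_ge0 ?subr_ge0 ?ltr_pdivrMr ?mul1r ?ltrBlDl //;
      case/andP: IH.
  rewrite ler_pdivlMr // ltr_pdivrMr // lerBrDl ltrBlDl => /andP[a b].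
  by exists U; rewrite ![PR _ _ * _]mulrC a.
have -> : dec x n = sel x (st x n) by [].
rewrite /sel stE /=; case: pickP => [//|/(_ U)]; by rewrite HU.
Qed.

Let histP n (w w' : walk) :
  hist n w = hist n w' <-> forall i, (i < n)%N -> w i = w' i.
Proof.
split=> [e i lt|e]; last first.
  by apply/eq_in_map => i; rewrite mem_iota add0n => /e.
by have := congr1 (fun s => nth (w i) s i) e; rewrite !nth_mkseq.
Qed.

Let hist_le m n (w w' : walk) : (m <= n)%N ->
  hist n w = hist n w' -> hist m w = hist m w'.
Proof.
move=> mn /histP e; apply/histP => i im; apply: e; exact: leq_trans mn.
Qed.

Let PR_hist n w w' : hist n w = hist n w' -> PR n w = PR n w'.
Proof.
move=> e; apply: eq_bigr => i _; rewrite (hist_le (ltnW (ltn_ord i)) e).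
by have /histP -> := e.
Qed.

Let LO_hist n w w' : hist n w = hist n w' -> LO n w = LO n w'.
Proof.
move=> e; apply: eq_bigr => i _.
have ei := hist_le (ltnW (ltn_ord i)) e.
by rewrite ei (PR_hist ei); have /histP -> := e.
Qed.

Let inI_hist x n w : 0 <= x < 1 -> inI n w x <-> hist n (dec x) = hist n w.
Proof.
move=> x01; split=> [|e]; last first.
  by rewrite /inI -(LO_hist e) -(PR_hist e); apply: inI_dec.
elim: n => // n IH.
rewrite /inI LOS PRS -addrA -mulrDr => /andP[xl xr].
have e : hist n (dec x) = hist n w.
  apply: IH; rewrite /inI (le_trans _ xl) ?lerDl ?mulr_ge0 //=.
  by rewrite (lt_le_trans xr) // lerD2l ler_piMr.
have := inI_dec n.+1 x01.
rewrite /inI LOS PRS -addrA -mulrDr e (LO_hist e) (PR_hist e) => /andP[yl yr].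
apply/histP => i; rewrite ltnS leq_eqVlt => /orP[/eqP ->|]; last first.
  by move=> lt; have /histP -> := e.
have no a b : LO n w + PR n w * c (hist n w) b <= x ->
    x < LO n w + PR n w * (c (hist n w) a + eta (hist n w) a) ->
    ~~ (enum_rank a < enum_rank b)%N.
  move=> hb ha; apply/negP => /(c_disj (hist n w)) le.
  have := le_lt_trans hb ha; apply/negP; rewrite -leNgt lerD2l.
  exact: ler_wpM2l.
case: (ltngtP (enum_rank (dec x n)) (enum_rank (w n))) => [lt|lt|e'].
- by have := no _ _ xl yr; rewrite lt.
- by have := no _ _ yl xr; rewrite lt.
- exact/enum_rank_inj/ord_inj.
Qed.

Let code (x : R) : sample_space eta :=
  if x \in `[0, 1[ then dec x else fun=> U0.

Let code_cylinder n w : code @^-1` (cylinder n w) `&` `[0, 1[%classic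
   = `[LO n w, LO n w + PR n w[%classic.
Proof.
have LO_ge0 : 0 <= LO n w.
  by apply: sumr_ge0 => i _; rewrite mulr_ge0.
have LO_le1 : LO n w + PR n w <= 1.
  elim: n {LO_ge0} => [|n IH]; first by rewrite /LO /PR !big_ord0 add0r.
  rewrite LOS PRS -addrA -mulrDr (le_trans _ IH) // lerD2l.
  by rewrite ler_piMr.
apply/seteqP; split=> x /=; rewrite !in_itv /= /code in_itv /=.
  by case=> + x01; rewrite x01 => /(inI_hist n w x01).
move=> xI; have x01 : 0 <= x < 1.
  by case/andP: xI => a b; rewrite (le_trans _ a) // (lt_le_trans b).
by split=> //; rewrite x01; apply/inI_hist.
Qed.

Let code_measurable : measurable_fun [set: measurableTypeR R] code.
Proof.
apply: (@measurability _ _ _ (sample_space eta) _ _ (cylinders eta)) => //.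
move=> _ [_ [n [w ->]] <-]; rewrite setTI.
have -> : code @^-1` (cylinder n w) =
    `[LO n w, LO n w + PR n w[%classic `|`
    (if hist n (fun=> U0) == hist n w then ~` `[0, 1[%classic else set0).
  rewrite -code_cylinder -[LHS](setUIDK _ `[0, 1[%classic).
  congr (_ `|` _); apply/seteqP; split=> x /=; rewrite /code /=.
    by case=> + /negP/negbTE x01; rewrite x01 => ->; rewrite eqxx /= x01.
  case: ifP => // /eqP e /= /negP/negbTE x01.
  by rewrite x01.
apply: measurableU => //; case: ifP => // _; exact: measurableC.
Qed.

Lemma walk_law_exists :
  exists P : probability (sample_space eta) R, is_walk_law P.
Proof.
pose T := measurableTypeR R.
pose mD : measurable (`[0, 1[%classic : set T) := measurable_itv _.
pose m : set T -> \bar R := mrestr (@lebesgue_measure R) mD.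
have m1 : m [set: T] = 1%:E.
  by rewrite /m /mrestr setTI lebesgue_measure_itv /= lte_fin ltr01 oppr0 adde0.
pose Q : probability T R :=
  HB.pack (mrestr (@lebesgue_measure R) mD)
    (Measure_isProbability.Build _ _ _ (mrestr (@lebesgue_measure R) mD) m1).
pose X : {mfun T >-> sample_space eta} :=
  HB.pack code (isMeasurableFun.Build _ _ T (sample_space eta) code code_measurable).
exists (distribution Q X) => n w.
rewrite /distribution /pushforward /= /mrestr code_cylinder.
rewrite lebesgue_measure_itv /= lte_fin ltrDl.
case: ifPn => [_|]; first by rewrite -EFinD addrAC subrr add0r.
by rewrite -leNgt => le0; congr EFin; apply/eqP; rewrite eq_le PR_ge0.
Qed.

Lemma walk_law_unique (P Q : probability (sample_space eta) R) :
  is_walk_law P -> is_walk_law Q ->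
  forall A : set (sample_space eta), measurable A -> P A = Q A.
Proof.
move=> hP hQ; pose G := cylinders eta `|` [set set0].
have GE : <<s cylinders eta >> = <<s G >>.
  apply/seteqP; split; first by apply: sub_sigma_algebra2 => C; left.
  apply: smallest_sub; first exact: smallest_sigma_algebra.
  move=> C [|->]; first exact: sub_sigma_algebra.
  exact: sigma_algebra0.
have GI : setI_closed G.
  move=> A B [[n [w ->]]|->]; last by rewrite set0I; right.
  move=> [[m [w' ->]]|->]; last by rewrite setI0; right.
  wlog nm : n m w w' / (n <= m)%N.
    by case: (leqP n m) => [le /(_ _ _ _ _ le)//|/ltnW le /(_ _ _ w' w le)];
      rewrite setIC.
  case: (eqVneq (hist n w) (hist n w')) => e.
    left; exists m, w'; apply/seteqP; split=> x /=; first by case.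
    by move=> xw'; split=> //; apply: (etrans (hist_le nm xw') (esym e)).
  right; apply/seteqP; split=> x //= [xw xw'].
  by case/eqP: e; apply: (etrans (esym xw) (hist_le nm xw')).
move=> A; have -> : measurable A = <<s G >> A by rewrite -GE.
apply: (@dynkin_induction _ (sample_space eta) G (fun A => P A = Q A)) => //.
- by rewrite !probability_setT.
- move=> C [[n [w ->]]|->]; first by rewrite hP hQ.
  by rewrite !measure0.
- by move=> S' mS e; rewrite !probability_setC // e.
- move=> F mF tF e.
  rewrite !measure_semi_bigcup //; try exact: bigcupT_measurable.
  by apply: eq_eseriesr => i _; apply: e.
Qed.


Definition walk_law : probability (sample_space eta) R :=
  projT1 (cid walk_law_exists).

Lemma walk_lawP : is_walk_law walk_law.
Proof. exact: projT2 (cid walk_law_exists). Qed.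

End walk_law.

(* [xget] picks the unique l with an attack after the first l rounds, if there
   is one; otherwise the attacker never attacks and the [None] branch applies. *)
Definition damage (R : realType) (G : game R) (k : nat) (pi : attacker G k)
    (w : walk G k) : R :=
  let l := xget 0%N [set l | pi (hist l w) != None] in
  if pi (hist l w) is Some v then
    (1 - detect G) ^+ (\sum_(i < attack_len v) (v \in val (w (l + i)%N)))
      * (cost v)%:R
  else 0.

Definition lev_against (R : realType) (G : game R) (k : nat)
    (eta : defender R G k) (pi : attacker G k) : \bar R :=
  ((max_cost G)%:R%:E - 'E_(walk_law eta)[damage pi])%E.

Definition lev (R : realType) (G : game R) (k : nat)
    (eta : defender R G k) : \bar R :=
  ereal_inf [set lev_against eta pi | pi in [set: attacker G k]].

Definition max_lev (R : realType) (G : game R) (k : nat) : \bar R :=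
  ereal_sup [set lev eta | eta in [set: defender R G k]].

Definition achievable (R : realType) (G : game R) (tau : R) (k : nat) : Prop :=
  (1 <= k <= #|G|)%N /\ (tau%:E <= max_lev G k)%E.

(* [^] is the power with an integer exponent, as Q v may be negative. *)
Definition solves (R : realType) (G : game R) (rho : R) (Q : G -> R) : Prop :=
  (detect G < 1 -> forall v : G,
     rho = (max_cost G)%:R - (cost v)%:R * (1 - detect G) ^ Num.floor (Q v)
             * (1 - detect G * (Q v - (Num.floor (Q v))%:~R))) /\
  (detect G = 1 -> forall v : G,
     rho = (max_cost G)%:R - (cost v)%:R * (1 - Q v)).

Definition admissible (R : realType) (G : game R) (Q : G -> R) : Prop :=
  (detect G < 1 -> forall v : G, Q v <= (attack_len v)%:R) /\
  (detect G = 1 -> forall v : G, Q v <= 1).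

Definition load (R : realType) (G : game R) (Q : G -> R) : R :=
  \sum_(v : G | 0 < Q v) Q v / (attack_len v)%:R.

(* Main.v *)
(* The Attacker may attack v after exactly l rounds, whatever was observed.
   Since (1-p)^c is convex in the number c of visits, the expected damage is at
   least the piecewise linear interpolation of that function at the expected
   number m of visits to v during the attack, and replacing the interpolation
   by its tangent at Q_v gives m >= Q_v + (Lev(eta) - rho) / s_v with slope
   s_v > 0.  Averaging over a number of rounds divisible by all the d(v), and
   using that every round contributes exactly k visits, yields
   k >= load Q + C * (Lev(eta) - rho) for a constant C >= 0 independent of eta,
   with C > 0 when load Q > 0; taking the supremum over eta gives (a) and the
   lower bound on k in (b).  If tau is achievable, d(v) visits at most are
   possible during an attack on v, so (alpha_max - tau) / alpha(v) is at least
   (1-p)^d(v), and the interpolation takes this value at some Q_v <= d(v). *)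
Require Import Defs.
From mathcomp Require Import all_boot all_order all_algebra.
From mathcomp Require Import all_classical all_reals all_analysis.
From mathcomp Require Import ring.

Set Implicit Arguments.
Unset Strict Implicit.
Unset Printing Implicit Defensive.

Import Order.TTheory GRing.Theory Num.Theory.

Local Open Scope ring_scope.

(** * Bernoulli's inequality and tangents of the interpolated power *)

Lemma bernoulli_expn (R : realDomainType) (x : R) (n : nat) :
  0 <= x -> 1 + (x - 1) * n%:R <= x ^+ n.
Proof.
move=> x0; elim: n => [|n IH]; first by rewrite mulr0 addr0 expr0.
have le : x * (1 + (x - 1) * n%:R) <= x ^+ n.+1 by rewrite exprS ler_wpM2l.
apply: le_trans le; rewrite -natr1 -subr_ge0.
have -> : x * (1 + (x - 1) * n%:R) - (1 + (x - 1) * (n%:R + 1))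
          = n%:R * (x - 1) ^+ 2 by ring.
by rewrite mulr_ge0 ?sqr_ge0.
Qed.

(** For a negative exponent the natural case is applied to [x^-1]; there [x^-1 - 1] is at least
    [1 - x], the difference being [(x - 1)^2 / x]. *)
Lemma bernoulli_exprz (R : realFieldType) (x : R) (z : int) :
  0 < x -> 1 + (x - 1) * z%:~R <= x ^ z.
Proof.
move=> x0; case: z => n; first by apply: bernoulli_expn; apply: ltW.
rewrite NegzE -exprnN -exprVn.
apply: le_trans (bernoulli_expn n.+1 _); last by rewrite invr_ge0 ltW.
rewrite mulrNz mulrN -mulNr lerD2l; apply: ler_wpM2r => //.
have : 0 <= (x - 1) ^+ 2 / x by rewrite divr_ge0 ?sqr_ge0 // ltW.
have -> : (x - 1) ^+ 2 / x = x^-1 - 1 - (- (x - 1)) by field; rewrite gt_eqF.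
by rewrite subr_ge0.
Qed.

(* The piecewise linear interpolation of the convex function c |-> (1-p)^c
   on the integers lies above each of its tangent lines; its value at Q v is
   prescribed by the system. *)
Lemma solves_tangent (R : realType) (G : game R) (rho : R) (Q : G -> R)
    (v : G) : solves rho Q ->
  exists s : R, 0 < s /\ forall c : nat,
    (max_cost G)%:R - rho - s * (c%:R - Q v)
      <= (1 - detect G) ^+ c * (cost v)%:R.
Proof.
move=> [lt1 eq1].
have a0 : 0 < (cost v)%:R :> R by rewrite ltr0n cost_gt0.
have p0 := detect_gt0 G.
have := detect_le1 G; rewrite le_eqVlt => /orP[/eqP p1|p1].
  exists (cost v)%:R; split=> // c; rewrite (eq1 p1 v) p1 subrr.
  have -> : (max_cost G)%:R
      - ((max_cost G)%:R - (cost v)%:R * (1 - Q v))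
      - (cost v)%:R * (c%:R - Q v) = (1 - c%:R) * (cost v)%:R :> R by ring.
  apply: ler_wpM2r; first exact: ltW.
  by case: c => [|c]; rewrite ?expr0 ?subr0 // expr0n /= subr_le0 ler1n.
have x0 : 0 < 1 - detect G by rewrite subr_gt0.
set n := Num.floor (Q v).
have y0 : 0 < (1 - detect G) ^ n by rewrite exprz_gt0.
(* This slope is the drop of [alpha(v) (1-p)^c] from [c = n] to [c = n + 1]. Bernoulli's inequality
   with exponent [c - n], scaled by [alpha(v) (1-p)^n], is then the tangent inequality. *)
exists ((cost v)%:R * detect G * (1 - detect G) ^ n).
split=> [|c]; first by rewrite !mulr_gt0.
have -> : (1 - detect G) ^+ c
    = (1 - detect G) ^ n * (1 - detect G) ^ (c%:Z - n).
  by rewrite -expfzDr ?gt_eqF // [n + _]addrC subrK.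
rewrite (lt1 p1 v) -/n -subr_ge0.
have := bernoulli_exprz (c%:Z - n) x0; rewrite -subr_ge0 intrD rmorphN /=.
move=> /(mulr_ge0 (ltW (mulr_gt0 a0 y0))) => h.
apply: le_trans h _; rewrite le_eqVlt; apply/orP; left; apply/eqP.
have -> : (c%:Z)%:~R = c%:R :> R by [].
ring.
Qed.

(** * Averaging over rounds *)

Lemma sum_weights_le (R : realType) (V : finType) (P : pred V)
    (d : V -> nat) (q : V -> R) (x : V -> nat -> R) (k : R) :
    (forall v, (0 < d v)%N) -> (forall v t, 0 <= x v t) ->
    (forall t, \sum_v x v t = k) ->
    (forall v l, P v -> q v <= \sum_(i < d v) x v (l + i)%N) ->
  \sum_(v | P v) q v / (d v)%:R <= k.
Proof.
(* [T] is a multiple of every [d v], so for each [v] the first [T] rounds split into whole blocks of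
   length [d v], each of weight at least [q v] when [P v] holds. *)
move=> d0 x0 xk xq; pose T := (\prod_v d v)%N.
have T0 : 0 < T%:R :> R by rewrite ltr0n prodn_gt0.
rewrite -(ler_pM2r T0).
have -> : k * T%:R = \sum_v \sum_(0 <= t < T) x v t.
  rewrite exchange_big /=; under eq_bigr do rewrite xk.
  by rewrite sumr_const_nat subn0 mulr_natr.
rewrite mulr_suml [leRHS](bigID P) /= -[leLHS]addr0.
apply: lerD; last by do 2 apply: sumr_ge0 => ? _.
apply: ler_sum => v Pv; pose e := (\prod_(u | u != v) d u)%N.
have -> : T = (e * d v)%N by rewrite /T (bigD1 v) //= mulnC.
have -> : q v / (d v)%:R * (e * d v)%:R = \sum_(0 <= i < e) q v.
  rewrite sumr_const_nat subn0 natrM -mulr_natr; field.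
  by rewrite pnatr_eq0 -lt0n.
rewrite big_nat_mul; apply: ler_sum => j _.
apply: le_trans (xq v (j * d v)%N Pv) _.
rewrite mulSn -[X in \sum_(X <= _ < _) _]add0n big_addn addnK big_mkord.
by under [leRHS]eq_bigr do rewrite addnC.
Qed.

(** * Integrals of functions of finitely many rounds; coverage of vertices *)

Definition depends_on (V : finType) (k n : nat) (T : Type)
    (X : walk V k -> T) : Prop :=
  forall w w', hist n w = hist n w' -> X w = X w'.

Lemma hist_nth (V : finType) (k n : nat) (w w0 : walk V k) :
  hist n (fun i => nth (w0 i) (hist n w) i) = hist n w.
Proof.
by apply/eq_in_map => i; rewrite mem_iota => /andP[_ lt]; rewrite nth_mkseq.
Qed.

Lemma eq_hist_nth (V : finType) (k n i : nat) (w w' : walk V k) :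
  (i < n)%N -> hist n w = hist n w' -> w i = w' i.
Proof.
move=> lt /(congr1 (fun s => nth (w i) s i)).
by rewrite /hist !nth_mkseq.
Qed.

Section expectation.
Variables (R : realType) (V : finType) (k : nat) (eta : defender R V k).
Local Notation T := (sample_space eta).
Local Notation P := (walk_law eta).
Implicit Type X : T -> R.

(** There are finitely many histories of length [n], so such an event is a finite union of
    cylinders. *)
Lemma depends_on_measurable n (A : set T) :
  depends_on n A -> measurable A.
Proof.
move=> nA.
have -> : A = (\bigcup_(s in [set s : n.-tuple (patrol V k) |
      exists2 w, A w & tval s = hist n w]) [set w | hist n w = tval s])%classic.
  apply/seteqP; split=> [w Aw|w [s [w' Aw' ->] /nA -> //]].
  by exists [tuple w i | i < n]; [exists w|]; rewrite //= ?val_mktuple;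
    rewrite /hist /mkseq -val_enum_ord -map_comp.
apply: fin_bigcup_measurable => [|s [w' _ ->]]; first exact: finite_finset.
by apply: sub_sigma_algebra; exists n, w'.
Qed.

Lemma depends_on_integrable n X :
  depends_on n X -> P.-integrable [set: T]%classic (EFin \o X).
Proof.
move=> nX; apply: measurable_bounded_integrable => //.
- exact: le_lt_trans (probability_le1 P measurableT) (ltry _).
- move=> _ B mB; rewrite setTI; apply: (@depends_on_measurable n) => w w' e.
  by rewrite /preimage /= (nX _ _ e).
(* [w0] only fills the rounds from [n] on, which do not affect [X]. The history of [w] is one of the
   finitely many [s], so the sum of all [|Y s|] bounds [|X w|]. *)
pose w0 : T := point.
pose Y (s : n.-tuple (patrol V k)) : R := X (fun i => nth (w0 i) s i).
exists (\sum_s `|Y s|); split=> [|M /ltW lt w _ /=]; first exact: num_real.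
apply: le_trans lt.
have sz : size (hist n w) == n by rewrite size_mkseq.
have -> : X w = Y (Tuple sz) by apply: nX; rewrite hist_nth.
by rewrite (bigD1 (Tuple sz)) //= lerDl sumr_ge0.
Qed.

Lemma Rintegral_sum (I : Type) (r : seq I) (F : I -> T -> R) :
    (forall i, P.-integrable [set: T]%classic (EFin \o F i)) ->
  \int[P]_w (\sum_(i <- r) F i w) = \sum_(i <- r) \int[P]_w F i w.
Proof.
move=> intF; elim: r => [|i r IH].
  rewrite big_nil -[RHS](mul0r (fine (P [set: T]%classic))) -Rintegral_cst //.
  by apply: eq_Rintegral => w _; rewrite big_nil.
rewrite big_cons -IH -RintegralD //.
  by apply: eq_Rintegral => w _; rewrite big_cons.
have -> : EFin \o (fun w => \sum_(j <- r) F j w)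
    = (fun w => \sum_(j <- r) (EFin \o F j) w)%E.
  by apply/funext => w /=; rewrite sumEFin.
exact: integrable_sum.
Qed.

Definition visits (v : V) (t : nat) : T -> R := fun w => (v \in val (w t))%:R.

(** The probability that round [t], counted from 0, visits [v], as the mean of an indicator. *)
Definition coverage (v : V) (t : nat) : R := \int[P]_w visits v t w.

Lemma visits_integrable v t :
  P.-integrable [set: T]%classic (EFin \o visits v t).
Proof.
apply: (@depends_on_integrable t.+1) => w w' e; rewrite /visits.
by rewrite (eq_hist_nth (ltnSn t) e).
Qed.

Lemma coverage_ge0 v t : 0 <= coverage v t.
Proof. by apply: Rintegral_ge0 => w _; rewrite ler0n. Qed.

Lemma Rintegral_walk_cst (r : R) : \int[P]_w r = r.
Proof.
rewrite Rintegral_cst //; transitivity (r * fine 1%E); last exact: mulr1.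
by congr (r * fine _); exact: probability_setT.
Qed.

Lemma sum_coverage t : \sum_v coverage v t = k%:R.
Proof.
rewrite -Rintegral_sum; last by move=> v; apply: visits_integrable.
rewrite -[RHS]Rintegral_walk_cst; apply: eq_Rintegral => w _.
rewrite /visits -natr_sum; congr _%:R.
apply: etrans (eqP (valP (w t))).
by rewrite -sum1_card [RHS]big_mkcond; apply: eq_bigr => v _; case: (v \in _).
Qed.

End expectation.

(** * Attacks launched at a fixed time *)

Lemma attack_at_once (V : finType) (k l : nat) (v : V) (h : seq (patrol V k)) :
    (if size h == l then Some v else None) != None ->
  forall j, (j < size h)%N ->
    (if size (take j h) == l then Some v else None) = None.
Proof.
case: ifP => // /eqP <- _ j lt.
by rewrite size_take lt ltn_eqF.
Qed.

Definition attack_at (V : finType) (k l : nat) (v : V) : attacker V k :=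
  Attacker (@attack_at_once V k l v).

Section attack_at.
Variables (R : realType) (G : game R) (k : nat) (eta : defender R G k).
Local Notation T := (sample_space eta).
Local Notation P := (walk_law eta).

Lemma damage_attack_at (l : nat) (v : G) (w : walk G k) :
  damage (attack_at k l v) w =
  (1 - detect G) ^+ (\sum_(i < attack_len v) (v \in val (w (l + i)%N)))
    * (cost v)%:R.
Proof.
rewrite /damage.
have -> : xget 0%N [set l' | attack_at k l v (hist l' w) != None]%classic = l.
  apply: xget_unique; first by rewrite /= size_mkseq eqxx.
  by move=> l'; rewrite /= size_mkseq; case: (eqVneq l' l).
by rewrite /= size_mkseq eqxx.
Qed.

Lemma damage_attack_at_integrable (l : nat) (v : G) :
  P.-integrable [set: T]%classic (EFin \o (damage (attack_at k l v) : T -> R)).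
Proof.
apply: (@depends_on_integrable _ _ _ _ (l + attack_len v)) => w w' e.
rewrite !damage_attack_at; congr (_ ^+ _ * _); apply: eq_bigr => i _.
by rewrite (eq_hist_nth _ e) // ltn_add2l.
Qed.

(** [lev eta] is an infimum over attackers, this one included. It is an extended real, so a real
    lower bound [r] stands in for it. *)
Lemma lev_attack_at (r : R) (l : nat) (v : G) : (r%:E <= lev eta)%E ->
  \int[P]_w damage (attack_at k l v) w <= (max_cost G)%:R - r.
Proof.
have le : (lev eta <= lev_against eta (attack_at k l v))%E.
  by apply: ereal_inf_lbound; exists (attack_at k l v).
move=> /le_trans/(_ le); rewrite /lev_against unlock.
have intD := damage_attack_at_integrable l v.
rewrite -(fineK (integrable_fin_num measurableT intD)).
by rewrite -EFinB lee_fin lerBrDl -lerBrDr.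
Qed.

(** An attack on [v] meets at most [attack_len v] visits, so even constant presence at [v] leaves
    this damage. *)
Lemma lev_fully_patrolled (r : R) (v : G) : (r%:E <= lev eta)%E ->
  (1 - detect G) ^+ attack_len v * (cost v)%:R <= (max_cost G)%:R - r.
Proof.
move=> /(lev_attack_at 0 v); apply: le_trans.
rewrite -[leLHS](Rintegral_walk_cst eta); apply: le_Rintegral => //.
- exact: (@depends_on_integrable _ _ _ _ 0).
- exact: damage_attack_at_integrable.
move=> w _; rewrite damage_attack_at ler_wpM2r //.
apply: ler_wiXn2l; first by rewrite subr_ge0 detect_le1.
  by rewrite gerBl ltW // detect_gt0.
rewrite -[leqRHS]card_ord -sum1_card; apply: leq_sum => i _; exact: leq_b1.
Qed.

(** The tangent bound is affine in the number of visits, so its expectation involves only the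
    expected number of visits, a sum of coverages; dividing by [s] isolates that sum. *)
Lemma lev_coverage (r rho s q : R) (l : nat) (v : G) :
    (forall c : nat, (max_cost G)%:R - rho - s * (c%:R - q)
      <= (1 - detect G) ^+ c * (cost v)%:R) ->
    0 < s -> (r%:E <= lev eta)%E ->
  q + s^-1 * (r - rho) <= \sum_(i < attack_len v) coverage eta v (l + i)%N.
Proof.
move=> tangent s0 /(lev_attack_at l v).
pose S (w : T) := \sum_(i < attack_len v) (visits v (l + i)%N : T -> R) w.
(* An arbitrary [f] covers the constant, linear and affine functions of [S] integrated below. *)
have intS (f : R -> R) : P.-integrable [set: T]%classic (EFin \o (f \o S)).
  apply: (@depends_on_integrable _ _ _ _ (l + attack_len v)) => w w' e.
  congr f; apply: eq_bigr => i _; rewrite /visits.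
  by rewrite (eq_hist_nth _ e) // ltn_add2l.
have ES : \int[P]_w S w
    = \sum_(i < attack_len v) coverage eta v (l + i)%N.
  by rewrite Rintegral_sum // => i; apply: visits_integrable.
have : \int[P]_w ((max_cost G)%:R - rho + s * q - s * S w)
    <= \int[P]_w damage (attack_at k l v) w.
  apply: le_Rintegral => //.
  - exact: (intS (fun x => (max_cost G)%:R - rho + s * q - s * x)).
  - exact: damage_attack_at_integrable.
  move=> w _; rewrite damage_attack_at; apply: le_trans (tangent _).
  rewrite natr_sum -/(S w) le_eqVlt; apply/orP; left; apply/eqP; ring.
rewrite RintegralB //; last 2 first.
- exact: (intS (fun=> (max_cost G)%:R - rho + s * q)).
- exact: (intS (fun x => s * x)).
rewrite Rintegral_walk_cst RintegralZl //; last exact: (intS id).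
rewrite ES => /le_trans h /h{h}; rewrite lerBlDr -subr_ge0 => h.
rewrite -(ler_pM2l s0) mulrDr mulrA divff ?gt_eqF // mul1r -subr_ge0.
apply: le_trans h _; rewrite le_eqVlt; apply/orP; left; apply/eqP; ring.
Qed.

(** The averaging inequality is applied to the coverages at the vertices with [0 < Q v]; the shift
    of [Q v] splits off as the second summand. *)
Lemma load_le (rho : R) (Q s : G -> R) (r : R) :
    (forall v, 0 < s v /\ forall c : nat,
      (max_cost G)%:R - rho - s v * (c%:R - Q v)
        <= (1 - detect G) ^+ c * (cost v)%:R) ->
    (r%:E <= lev eta)%E ->
  load Q + (\sum_(v | 0 < Q v) (s v)^-1 / (attack_len v)%:R) * (r - rho)
    <= k%:R.
Proof.
move=> tangent lev_r.
have := sum_weights_le (P := fun v => 0 < Q v)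
  (q := fun v => Q v + (s v)^-1 * (r - rho)) (@attack_len_gt0 _ G)
  (@coverage_ge0 _ _ _ eta) (@sum_coverage _ _ _ eta) _.
have h v l : 0 < Q v -> Q v + (s v)^-1 * (r - rho)
    <= \sum_(i < attack_len v) coverage eta v (l + i)%N.
  by move=> _; have [s0 h] := tangent v; apply: lev_coverage.
move=> /(_ h); apply: le_trans.
rewrite /load mulr_suml -big_split le_eqVlt; apply/orP; left; apply/eqP.
by apply: eq_bigr => v _ /=; rewrite mulrDl [_ * _ / _]mulrAC.
Qed.

End attack_at.

(** * Passing to the supremum over defenders *)

Lemma load_bound (R : realType) (G : game R) (rho : R) (Q : G -> R) :
    solves rho Q ->
  exists C : R, [/\ 0 <= C, 0 < load Q -> 0 < C &
    forall k (eta : defender R G k) (r : R), (r%:E <= lev eta)%E ->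
      load Q + C * (r - rho) <= k%:R].
Proof.
move=> solQ; have [s tangent] := choice (fun v => solves_tangent v solQ).
have C0 v : 0 < (s v)^-1 / (attack_len v)%:R.
  have [? _] := tangent v.
  by rewrite divr_gt0 ?invr_gt0 // ltr0n attack_len_gt0.
(* The slopes come from [Q] and [rho] alone, so this constant serves all [k] and [eta]. *)
exists (\sum_(v | 0 < Q v) (s v)^-1 / (attack_len v)%:R); split.
- by apply: sumr_ge0 => v _; apply: ltW.
- have [v Qv _|noQ] := pickP (fun v => 0 < Q v).
    rewrite (bigD1 v) //= ltr_pwDl // sumr_ge0 // => u _; exact: ltW.
  by rewrite /load big_pred0 // ltxx.
- by move=> k eta r; apply: load_le.
Qed.

Lemma max_lev_gt (R : realType) (G : game R) (k : nat) (x : R) :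
  (x%:E < max_lev G k)%E ->
  exists (eta : defender R G k) (r : R), x < r /\ (r%:E <= lev eta)%E.
Proof.
move=> /ereal_sup_gt[_ [eta _ <-]]; case E : (lev eta) => [r| |//] xr.
- by exists eta, r; rewrite -lte_fin E.
(* If [lev eta] were [+oo], any real above [x] would do. *)
- by exists eta, (x + 1); rewrite ltrDl E leey.
Qed.

(** A defender guaranteeing [r > rho] would force [C * (r - rho) <= 0], while [load Q = k > 0] makes
    [C] positive. *)
Lemma max_lev_le (R : realType) (G : game R) (k : nat) (rho : R) (Q : G -> R) :
  (1 <= k)%N -> solves rho Q -> k%:R = load Q -> (max_lev G k <= rho%:E)%E.
Proof.
move=> k1 /load_bound[C [_ Cgt0 bound]] kQ; rewrite leNgt; apply/negP.
move=> /max_lev_gt[eta [r [rho_r /bound]]].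
rewrite kQ gerDl leNgt mulr_gt0 ?subr_gt0 ?Cgt0 //.
by rewrite -kQ ltr0n.
Qed.

(** The supremum need not be attained, hence the loss of [e]. *)
Lemma achievable_defender (R : realType) (G : game R) (tau : R) (k : nat)
    (e : R) : 0 < e -> achievable G tau k ->
  exists eta : defender R G k, ((tau - e)%:E <= lev eta)%E.
Proof.
move=> e0 [_ tau_le].
have /max_lev_gt[eta [r [lt le]]] : ((tau - e)%:E < max_lev G k)%E.
  by apply: lt_le_trans tau_le; rewrite lte_fin gtrBl.
by exists eta; apply: le_trans le; rewrite lee_fin ltW.
Qed.

Lemma achievable_load_le (R : realType) (G : game R) (tau : R) (k : nat)
    (Q : G -> R) :
  achievable G tau k -> solves tau Q -> load Q <= k%:R.
Proof.
move=> ach /load_bound[C [C0 _ bound]]; apply/ler_addgt0Pr => e e0.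
(* A deficit of [e / (C + 1)] costs at most [e] in the bound; the added 1 covers [C = 0]. *)
have C1 : 0 < C + 1 by rewrite ltr_wpDl.
have [eta /bound] := achievable_defender (divr_gt0 e0 C1) ach.
rewrite [_ - _ - _]addrAC subrr add0r mulrN lerBlDr => /le_trans; apply.
rewrite lerD2l mulrCA ler_piMr ?(ltW e0) //.
by rewrite ler_pdivrMr // mul1r lerDl ler01.
Qed.

Lemma achievable_fully_patrolled (R : realType) (G : game R) (tau : R) (k : nat)
    (v : G) : achievable G tau k ->
  (1 - detect G) ^+ attack_len v * (cost v)%:R <= (max_cost G)%:R - tau.
Proof.
move=> ach; apply/ler_addgt0Pr => e e0.
have [eta /(lev_fully_patrolled v)] := achievable_defender e0 ach.
by rewrite opprB addrA [_ + e - _]addrAC.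
Qed.

(** * Solvability of the system *)

Lemma interpolation_ex (R : realType) (p g : R) (d : nat) :
    0 < p -> p < 1 -> (1 - p) ^+ d <= g ->
  exists q : R, q <= d%:R /\
    g = (1 - p) ^ Num.floor q * (1 - p * (q - (Num.floor q)%:~R)).
Proof.
move=> p0 p1 hg; have x0 : 0 < 1 - p by rewrite subr_gt0.
have g0 : 0 < g by apply: lt_le_trans hg; rewrite exprn_gt0.
have exj : exists j : nat, g <= (1 - p) ^ (d%:Z - j%:Z).
  (* By Bernoulli's inequality [(1-p)^(-j) >= 1 + j p], so such a [j] is large enough. *)
  have [j hj] : exists j : nat, (g / (1 - p) ^+ d - 1) / p <= j%:R.
    by eexists; apply/ltW/truncnS_gt.
  exists j; rewrite expfzDr ?gt_eqF // mulrC -ler_pdivrMr ?exprn_gt0 //.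
  apply: le_trans (bernoulli_exprz _ x0).
  have -> : (1 - p - 1) * (- j%:Z)%:~R = j%:R * p.
    rewrite rmorphN /= (_ : (j%:Z)%:~R = j%:R :> R) //; ring.
  by rewrite -lerBlDl -ler_pdivrMr.
case: (ex_minnP exj) => j gj minj; pose n := d%:Z - j%:Z.
have y0 : 0 < (1 - p) ^ n by rewrite exprz_gt0.
pose t := (1 - g / (1 - p) ^ n) / p.
have t0 : 0 <= t.
  by rewrite /t divr_ge0 ?(ltW p0) // subr_ge0 ler_pdivrMr // mul1r.
have t1 : t < 1.
  rewrite /t ltr_pdivrMr // mul1r ltrBlDr -ltrBlDl ltr_pdivlMr //.
  (* It remains to see that [(1-p)^(n+1) < g]: for [j = 0] this follows from [hg], otherwise from
     minimality. *)
  case: j @n gj minj @t t0 y0 => [|j] n gj minj t t0 y0.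
    apply: lt_le_trans hg; rewrite /n subr0 gtr_pMl ?exprn_gt0 //.
    by rewrite gtrBl.
  rewrite ltNge; apply/negP => le.
  have /minj : g <= (1 - p) ^ (d%:Z - j%:Z).
    apply: le_trans le _; rewrite -[X in X * _]expr1z -expfzDr ?gt_eqF //.
    by rewrite (_ : 1 + n = d%:Z - j%:Z) // /n -addn1 PoszD; ring.
  by rewrite ltnn.
have jn : n%:~R <= d%:R :> R.
  by rewrite /n intrD rmorphN /= gerBl ler0n.
have fl : Num.floor (n%:~R + t) = n.
  by apply: floor_def; rewrite lerDl t0 intrD ltrD2l.
exists (n%:~R + t); rewrite fl; split; last first.
  rewrite addrAC subrr add0r /t; field; rewrite !gt_eqF //.
(* For [j = 0], [hg] forces [t <= 0]; otherwise [n <= d - 1] and [t < 1]. *)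
case: j @n gj minj jn @t t0 t1 y0 fl => [|j] n gj minj jn t t0 t1 y0 fl.
  rewrite /n subr0 gerDl /t pmulr_lle0 ?invr_gt0 // subr_le0.
  by rewrite ler_pdivlMr // mul1r /n subr0.
rewrite (le_trans (lerD (lexx _) (ltW t1))) // /n -addn1 PoszD.
rewrite (_ : _ + 1 = d%:R - j%:R) ?gerBl ?ler0n //.
rewrite !(intrD, rmorphN) /=; ring.
Qed.

(** Once [rho = tau] is fixed, each equation involves a single [Q v] and is solved separately; the
    damage left by a full patrol gives the upper bound on [Q v]. *)
Lemma solution_ex (R : realType) (G : game R) (tau : R) (k : nat) :
  achievable G tau k -> exists Q : G -> R, solves tau Q /\ admissible Q.
Proof.
move=> ach; pose g (v : G) : R := ((max_cost G)%:R - tau) / (cost v)%:R.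
have a0 (v : G) : 0 < (cost v)%:R :> R by rewrite ltr0n cost_gt0.
have tauE v : tau = (max_cost G)%:R - (cost v)%:R * g v.
  by rewrite /g mulrC divfK ?gt_eqF // opprB addrC subrK.
have gP v : (1 - detect G) ^+ attack_len v <= g v.
  by rewrite ler_pdivlMr //; apply: achievable_fully_patrolled ach.
have := detect_le1 G; rewrite le_eqVlt => /orP[/eqP p1|p1].
  exists (fun v => 1 - g v); split; split; rewrite p1 ?ltxx // => _ v.
    by rewrite subKr.
  rewrite gerBl; apply: le_trans (gP v).
  by rewrite exprn_ge0 // subr_ge0 p1.
have [Q QP] := choice (fun v => interpolation_ex (detect_gt0 G) p1 (gP v)).
exists Q; split; split=> [_ v|p1']; try by rewrite p1' ltxx in p1.
  by have [_ gE] := QP v; rewrite -mulrA -gE.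
by have [] := QP v.
Qed.

Theorem theorem1 (R : realType) (G : game R) (G_nonempty : (0 < #|G|)%N) :
  (forall (k : nat) (rho : R) (Q : G -> R),
     (1 <= k <= #|G|)%N ->
     solves rho Q -> k%:R = load Q ->
     (max_lev G k <= rho%:E)%E) /\
  (forall tau : R, 0 <= tau ->
     (~ (exists (rho : R) (Q : G -> R),
           [/\ solves rho Q, tau = rho & admissible Q]) ->
      forall k : nat, ~ achievable G tau k) /\
     ((exists (rho : R) (Q : G -> R),
         [/\ solves rho Q, tau = rho & admissible Q]) ->
      forall k : nat, achievable G tau k ->
      forall (rho : R) (Q : G -> R), solves rho Q -> tau = rho ->
        Num.ceil (load Q) <= k%:Z)).

Proof.
split=> [k rho Q /andP[k1 _]|tau _]; first exact: max_lev_le.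
split=> [no_sol k ach|_ k ach rho Q solQ tauE]; last first.
  by rewrite ceil_le_int; apply: achievable_load_le ach _; rewrite tauE.
apply: no_sol; exists tau.
have [Q [solQ admQ]] := solution_ex ach.
by exists Q.
Qed.
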